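(* Let $-2<s<0$, and let $(a_n)_{n=0}^\infty\subset S^1$ be a greedy $s$-energy sequence. Then $$\lim_{N\to\infty}\frac1N\sum_{k=1}^N\bigl(U_{k,s}(a_k)-kI_s(\sigma)\bigr)=\frac{I_s(\sigma)}{2}.$$ In fact, $$\frac1N\sum_{k=1}^N\bigl(U_{k,s}(a_k)-kI_s(\sigma)\bigr)-\frac{I_s(\sigma)}2=\begin{cases}O(N^s),&-1<s<0,\\ O(N^{-1}\log N),&s=-1,\\ O(N^{-1}),&-2<s<-1.\end{cases}$$
   Context: $S^1=\{z\in\mathbb{C}:|z|=1\}$. For $s<0$ the Riesz kernel is $k_s(z,w)=|z-w|^{-s}$. For points $z_1,\dots,z_N$, $N\geq 2$, the energy is $E_s((z_1,\dots,z_N))=\sum_{1\le i\ne j\le N}k_s(z_i,z_j)$. For $s<0$, a greedy $s$-energy sequence is a sequence $(a_n)_{n=0}^\infty\subset S^1$ with $a_0\in S^1$ arbitrary and $E_s((a_0,\dots,a_{N-1},a_N))=\max_{z\in S^1}E_s((a_0,\dots,a_{N-1},z))$ for all $N\ge1$. The potential of the first $N$ points is $U_{N,s}(z)=\sum_{\ell=0}^{N-1}k_s(z,a_\ell)$, $N\ge1$. $\sigma$ is the arclength measure on $S^1$ normalized by $\sigma(S^1)=1$, and $I_s(\sigma)=\iint_{S^1\times S^1}|x-y|^{-s}d\sigma(x)d\sigma(y)=\frac{2^{-s}}{\sqrt\pi}\frac{\Gamma((1-s)/2)}{\Gamma(1-s/2)}$. The $O$-estimates are as $N\to\infty$, with constants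 that may depend on $s$. *)

(* Defs.v *)
From HB Require Import structures.
From mathcomp Require Import all_boot all_order all_algebra complex.
From mathcomp Require Import all_classical all_reals all_analysis.

Set Implicit Arguments.
Unset Strict Implicit.
Unset Printing Implicit Defensive.

Import Order.TTheory GRing.Theory Num.Theory.
Import numFieldNormedType.Exports.
Import ComplexField.Normc.

Local Open Scope classical_set_scope.
Local Open Scope ring_scope.
Local Open Scope complex_scope.

(* The complex plane with its Borel sigma-algebra.  The topology of R[i] is the
   one of the numFieldType R[i], which the library infers on the alias
   (R[i])^o. *)
Notation borelC R := (g_sigma_algebraType (@open (R[i])^o)).

Definition circle (R : realType) : set R[i] := [set z | normc z = 1].

Section circle_measure.
Variable R : realType.

Definition expi (t : measurableTypeR R) : borelC R :=
  (cos (t : R) +i* sin (t : R) : R[i]).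

Lemma normc_le_ReIm (z : R[i]) :
  normc z <= `|complex.Re z| + `|complex.Im z|.
Proof.
case: z => x y /=.
rewrite -[leRHS](ger0_norm (addr_ge0 (normr_ge0 x) (normr_ge0 y))) -sqrtr_sqr.
apply: ler_wsqrtr; rewrite sqrrD !real_normK ?num_real//.
by rewrite addrAC lerDl mulrn_wge0// mulr_ge0.
Qed.

Lemma continuous_expi : continuous (expi : R -> (R[i])^o).
Proof.
move=> t; apply/cvgrPdist_lt => -[e e'].
rewrite ltcE => /andP[/= /eqP e'0 e0]; rewrite {e'}e'0.
have e20 : 0 < e / 2 by rewrite divr_gt0.
have /cvgrPdist_lt/(_ _ e20) Hc := @continuous_cos R t.
have /cvgrPdist_lt/(_ _ e20) Hs := @continuous_sin R t.
near=> u; rewrite ltcE /= eqxx /=.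
apply: (@le_lt_trans _ _
  (normc ((cos t +i* sin t) - (cos u +i* sin u) : R[i]))) => //.
apply: le_lt_trans (normc_le_ReIm _) _ => /=.
by rewrite [ltRHS]splitr ltrD//; near: u.
Unshelve. all: by end_near. Qed.

Lemma measurable_expi : measurable_fun [set: measurableTypeR R] expi.
Proof.
apply: (@measurability _ _ _ (borelC R) setT expi (@open (R[i])^o)) => //.
move=> _ [A oA <-]; rewrite setTI; apply: measurable_realfun.open_measurable.
by apply: open_comp => // t _; exact: continuous_expi.
Qed.

HB.instance Definition _ := isMeasurableFun.Build _ _ _ _ expi measurable_expi.

Lemma lt0_2pi : 0 < 2 * pi :> R.
Proof. by rewrite mulr_gt0// pi_gt0. Qed.

(* Normalized arclength: the image of the uniform probability dt / (2 pi) on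
   [0, 2 pi] by the unit-speed parametrization t |-> e^(it). *)
Definition sigma : probability (borelC R) R :=
  distribution (uniform_prob lt0_2pi) expi.

End circle_measure.
Arguments sigma {R}.
Arguments circle {R}.

(* With s < 0 the value on the diagonal is 0 `^ (- s) = 0. *)
Definition riesz_kernel (R : realType) (s : R) (z w : R[i]) : R :=
  normc (z - w) `^ (- s).

Definition energy (R : realType) (s : R) (z : seq R[i]) : R :=
  \sum_(i < size z) \sum_(j < size z | j != i) riesz_kernel s z`_i z`_j.

Definition is_maximum (R : realType) (A : set R) (m : R) : Prop :=
  A m /\ ubound A m.

Definition greedy (R : realType) (s : R) (a : nat -> R[i]) : Prop :=
  (forall n, circle (a n)) /\
  forall N, (1 <= N)%N ->
    is_maximum [set energy s (rcons (mkseq a N) z) | z in circle]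
      (energy s (rcons (mkseq a N) (a N))).

Definition potential (R : realType) (s : R) (a : nat -> R[i]) (N : nat)
    (z : R[i]) : R :=
  \sum_(l < N) riesz_kernel s z (a l).

Definition energy_sigma (R : realType) (s : R) : R :=
  \int[sigma]_(x in circle) \int[sigma]_(y in circle) riesz_kernel s x y.

Definition mean_deviation (R : realType) (s : R) (a : nat -> R[i]) (N : nat) :
    R :=
  N%:R^-1 *
  \sum_(1 <= k < N.+1) (potential s a k (a k) - k%:R * energy_sigma s).

(* Main.v *)
Require Import Defs.
From mathcomp Require Import all_boot all_order all_algebra complex.
From mathcomp Require Import all_classical all_reals all_analysis.
From mathcomp Require Import measurable_realfun ring lra.

(** Put q = -s/2, so 0 < q < 1 and the kernel is the q-th power of the squared
    chord x = 2 - 2 cos t, and write I for [energy_sigma s].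

    Powers as mixtures.  Up to a constant, x^q is the integral over u > 0 of
    x / (x + u) u^(q-1) du.  Hence inequalities between sums of the rational
    functions x / (x + u), valid for every u, pass to sums of powers
    ([le_sum_powR], [lt_sum_powR]).  For the rational functions everything is
    explicit: with c = 1 + u/2 one has x + u = 2 (c - cos t), and the sum of
    1 / (c - cos) over 2^n equally spaced angles has a closed form, obtained by
    doubling the number of points ([root_systemS]).  Two facts about the
    potential V of the M = 2^n roots of z^M = w follow: V is maximal exactly at
    the midpoints z^M = -w, and max V - min V is at most a constant times M^s
    ([root_potential_gap]).  As the mean of V over the circle
    is M I ([potential_mean_bounds]), V is within O(M^s) of M I everywhere.

    Binary structure.  The first M points of a greedy sequence form such a root
    system, and the next points, as long as there are at most M of them, sit on
    its midpoints and are again greedy ([greedy_binary_structure],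
    [greedy_tail]).  Indeed these points maximize V plus the potential of their
    predecessors within the block, and by induction both summands can be maximized
    simultaneously.

    Energy.  Cutting off the largest power of 2 in N, then the next one, and so
    on, the energy of the first N points differs from N^2 I by at most a
    constant times the sum of M^(1+s) over the powers M of 2 not exceeding N
    ([pair_energy_deviation]).  That geometric sum is O(N^(1+s)), O(log N) or
    O(1) according to the sign of 1 + s.  The quantity of the theorem is
    (E - (N+1)^2 I + I) / (2N), where E is the energy of the first N + 1 points
    ([mean_deviationE]). *)

Import Order.TTheory GRing.Theory Num.Theory.
Import numFieldNormedType.Exports.

Local Open Scope classical_set_scope.
Local Open Scope ring_scope.

(** * Powers as mixtures of rational functions *)

Section stieltjes.
Context {R : realType}.
Implicit Types (q x y : R).
Notation mu := (@lebesgue_measure R).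

(** Up to a constant depending on q, [x `^ q] is the integral over u > 0 of
    x / (x + u) u^(q-1) du; this is the integrand after the substitution
    u = e^y, which turns dilations of x into translations of y. *)
Definition stieltjes q x y : R := x * expR (q * y) / (x + expR y).

Lemma stieltjes_den_gt0 x y : 0 <= x -> 0 < x + expR y.
Proof. by move=> x0; rewrite ltr_wpDl// expR_gt0. Qed.

Lemma stieltjes_ge0 q x y : 0 <= x -> 0 <= stieltjes q x y.
Proof.
move=> x0; rewrite /stieltjes divr_ge0 ?mulr_ge0 ?expR_ge0//.
by rewrite ltW// stieltjes_den_gt0.
Qed.

Lemma continuous_stieltjes q x : 0 <= x -> continuous (stieltjes q x).
Proof.
move=> x0 y; rewrite /stieltjes; apply: cvgM.
  apply: cvgM; first exact: cvg_cst.
  apply: continuous_comp; last exact: continuous_expR.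
  by apply: cvgM; [exact: cvg_cst|exact: cvg_id].
apply: cvgV; first by rewrite gt_eqF// stieltjes_den_gt0.
by apply: cvgD; [exact: cvg_cst|exact: continuous_expR].
Qed.

Lemma measurable_stieltjes q x : 0 <= x ->
  measurable_fun [set: R] (EFin \o stieltjes q x).
Proof.
move=> x0; apply/measurable_EFinP; apply: continuous_measurable_fun.
exact: continuous_stieltjes.
Qed.

(** Translating y by ln x pulls out the factor [x `^ q], so the value of the
    constant at x = 1 never has to be computed. *)
Lemma integral_stieltjes_scale q x : 0 < q -> 0 <= x ->
  (\int[mu]_y (stieltjes q x y)%:E =
   (x `^ q)%:E * \int[mu]_y (stieltjes q 1 y)%:E)%E.
Proof.
move=> q0; rewrite le_eqVlt => /predU1P[<-|x0].
  rewrite powR0 ?gt_eqF// mul0e; apply: integral0_eq => y _.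
  by rewrite /stieltjes !mul0r.
have D1 : (fun y : R => y + ln x)^`()%classic = cst 1.
  apply/funext => y; rewrite derive1E deriveD//.
  by rewrite derive_id derive_cst addr0.
rewrite (@increasing_ge0_integration_by_substitutionT R (fun y => y + ln x)).
- rewrite -(@ge0_integralZl _ (measurableTypeR R) R mu setT measurableT)//; last 3 first.
  + exact: measurable_stieltjes.
  + by move=> y _; rewrite lee_fin stieltjes_ge0.
  + exact: powR_ge0.
  apply: eq_integral => y _; rewrite -EFinM; congr EFin.
  rewrite D1 /= !fctE /= mulr1 /stieltjes /powR gt_eqF//.
  rewrite mulrDr !expRD lnK ?posrE//.
  have ey := expR_gt0 y.
  field.
  by rewrite !gt_eqF// ?addr_gt0// ?mulr_gt0// addr_gt0.
- by move=> u v uv; rewrite ltrD2r.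
- by rewrite D1; exact: cst_continuous.
- by rewrite D1; exact: is_cvg_cst.
- by rewrite D1; exact: is_cvg_cst.
- by move=> y; exact: derivableD.
- apply/cvgrNyPle => A; near=> y.
  by rewrite -lerBrDr; near: y; apply: nbhs_ninfty_le; rewrite num_real.
- apply/cvgryPge => A; near=> y.
  by rewrite -lerBlDr; near: y; apply: nbhs_pinfty_ge; rewrite num_real.
- exact/continuous_stieltjes/ltW.
- by move=> y; apply/stieltjes_ge0/ltW.
Unshelve. all: by end_near. Qed.

(** At x = 1 the integrand decays like e^(-c|y|) with c = min(q, 1 - q), which
    is where both bounds on q are needed. *)
Lemma integral_stieltjes1_lty q : 0 < q < 1 ->
  (\int[mu]_y (stieltjes q 1 y)%:E < +oo)%E.
Proof.
move=> /andP[q0 q1].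
pose c := Num.min q (1 - q).
have c0 : 0 < c by rewrite lt_min q0 subr_gt0.
pose g y : R := expR (- c * `|y|).
have cg : continuous g.
  move=> y; apply: continuous_comp; last exact: continuous_expR.
  by apply: cvgM; [exact: cvg_cst|exact: norm_continuous].
have mg : measurable_fun setT (EFin \o g).
  by apply/measurable_EFinP; exact: continuous_measurable_fun.
apply: (@le_lt_trans _ _ (\int[mu]_y (g y)%:E)%E).
  apply: ge0_le_integral => //.
  - by move=> y _; rewrite lee_fin stieltjes_ge0.
  - exact: measurable_stieltjes.
  - move=> y _; rewrite lee_fin /stieltjes mul1r /g.
    have cq : c <= q by rewrite ge_min lexx.
    have cq1 : c <= 1 - q by rewrite ge_min lexx orbT.
    rewrite ler_pdivrMr ?stieltjes_den_gt0//.
    rewrite mulrDr mulr1 -expRD.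
    have [y0|y0] := leP 0 y.
      apply: ler_wpDl; first exact: expR_ge0.
      rewrite ler_expR ger0_norm//.
      have : c * y <= (1 - q) * y by rewrite ler_wpM2r.
      by lra.
    apply: ler_wpDr; first exact: expR_ge0.
    rewrite ler_expR ltr0_norm//.
    have : (- y) * c <= (- y) * q by rewrite ler_wpM2l// oppr_ge0 ltW.
    by lra.
rewrite ge0_symfun_integralT//; last 2 first.
- by move=> y; exact: expR_ge0.
- by move=> y; rewrite /g /= normrN.
rewrite lte_mul_pinfty//.
apply: (@le_lt_trans _ _ (\int[mu]_y (c^-1%:E * (exponential_pdf c y)%:E))%E).
  rewrite integral_mkcond; apply: ge0_le_integral => //.
  - by move=> y _; rewrite erestrict_ge0// => z _; rewrite lee_fin expR_ge0.
  - apply/(measurable_restrictT _ _).1 => //.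
      by rewrite -set_itvcy.
    exact: measurable_funTS.
  - by apply: measurable_funeM; apply/measurable_EFinP;
      exact: measurable_exponential_pdf.
  - move=> y _; rewrite patchE; case: ifPn => y0; last first.
      by rewrite -EFinM lee_fin mulr_ge0 ?invr_ge0 ?exponential_pdf_ge0// ltW.
    move: y0; rewrite inE /= => y0.
    rewrite exponential_pdfE// -EFinM lee_fin /g.
    by rewrite ger0_norm// mulrA mulVf ?gt_eqF// mul1r.
rewrite (@ge0_integralZl _ (measurableTypeR R) R mu setT measurableT)//; last 3 first.
- by apply/measurable_EFinP; exact: measurable_exponential_pdf.
- by move=> y _; rewrite lee_fin exponential_pdf_ge0// ltW.
- by rewrite lee_fin invr_ge0 ltW.
by rewrite integral_exponential_pdf// mule1 ltry.
Qed.

Lemma integrable_stieltjes q x : 0 < q < 1 -> 0 <= x ->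
  mu.-integrable setT (EFin \o stieltjes q x).
Proof.
move=> q01 x0; apply/integrableP; split.
  exact: measurable_stieltjes.
under eq_integral do rewrite gee0_abs ?lee_fin ?stieltjes_ge0//.
rewrite integral_stieltjes_scale//; last by case/andP: q01.
by rewrite lte_mul_pinfty ?lee_fin ?powR_ge0// integral_stieltjes1_lty.
Qed.

Lemma Rintegral_stieltjes q x : 0 < q < 1 -> 0 <= x ->
  \int[mu]_y stieltjes q x y = x `^ q * \int[mu]_y stieltjes q 1 y.
Proof.
move=> q01 x0; rewrite /Rintegral integral_stieltjes_scale//; last first.
  by case/andP: q01.
by rewrite fineM//; apply: integrable_fin_num => //; exact: integrable_stieltjes.
Qed.

(** With a zero integral f would vanish almost everywhere, whereas it vanishes
    nowhere and the line is not a null set. *)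
Lemma Rintegral_gt0 (f : R -> R) : mu.-integrable setT (EFin \o f) ->
  (forall y, 0 < f y) -> 0 < \int[mu]_y f y.
Proof.
move=> fi f0; rewrite lt_neqAle Rintegral_ge0 ?andbT; last first.
  by move=> y _; exact: ltW.
apply/eqP => If.
have mf : measurable_fun setT (EFin \o f) by case/integrableP: fi.
have : (\int[mu]_y `|(EFin \o f) y| = 0)%E.
  under eq_integral do rewrite /= ger0_norm ?(ltW (f0 _))//.
  rewrite -[LHS]fineK; last exact: integrable_fin_num.
  by rewrite [fine _](esym If).
move/(iffLR (ae_eq_integral_abs mu measurableT mf)) => f_ae0.
have [A [mA A0 subA]] : mu.-negligible (~` [set y | setT y -> (f y)%:E = 0%E]).
  exact: f_ae0.
have AT : A = setT.
  apply/seteqP; split=> // y _; apply: subA => /= /(_ I) [].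
  by move/eqP; rewrite gt_eqF.
move: A0; rewrite AT => muT.
have := @lebesgue_measure_itv R `]0, 1[.
rewrite /= lte_fin ltr01 oppr0 adde0 => mu1.
have : (mu `]0%R, 1%R[ <= mu setT)%E by apply: le_measure; rewrite ?inE.
by rewrite muT mu1 lee_fin leNgt ltr01.
Qed.

Lemma integrable_sum_stieltjes q (xs : seq R) : 0 < q < 1 ->
  all (<=%R 0) xs ->
  mu.-integrable setT (EFin \o (fun y => \sum_(x <- xs) stieltjes q x y)).
Proof.
move=> q01; elim: xs => [_|x xs IH /= /andP[x0 xs0]].
  rewrite (_ : _ \o _ = cst 0%E); first exact: integrable0.
  by apply/funext => y /=; rewrite big_nil.
rewrite (_ : _ \o _ = (EFin \o stieltjes q x) \+
   (EFin \o (fun y => \sum_(x <- xs) stieltjes q x y)%R))%E; last first.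
  by apply/funext => y /=; rewrite big_cons.
apply: integrableD => //; first exact: integrable_stieltjes.
exact: IH.
Qed.

Lemma Rintegral_sum_stieltjes q (xs : seq R) : 0 < q < 1 ->
  all (<=%R 0) xs ->
  \int[mu]_y (\sum_(x <- xs) stieltjes q x y) =
  (\sum_(x <- xs) x `^ q) * \int[mu]_y stieltjes q 1 y.
Proof.
move=> q01; elim: xs => [_|x xs IH /= /andP[x0 xs0]].
  rewrite big_nil mul0r.
  under eq_Rintegral do rewrite big_nil.
  by rewrite Rintegral_cst// mul0r.
rewrite big_cons mulrDl -IH// -Rintegral_stieltjes// -RintegralD//.
- by apply: eq_Rintegral => y _; rewrite big_cons.
- exact: integrable_stieltjes.
- exact: integrable_sum_stieltjes.
Qed.

Lemma stieltjesE q x y :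
  stieltjes q x y = expR (q * y) * (x / (x + expR y)).
Proof. by rewrite /stieltjes mulrAC mulrC mulrA. Qed.

Lemma Rintegral_stieltjes1_gt0 q : 0 < q < 1 ->
  0 < \int[mu]_y stieltjes q 1 y.
Proof.
move=> q01; apply: Rintegral_gt0; first exact: integrable_stieltjes.
by move=> y; rewrite /stieltjes divr_gt0 ?mulr_gt0 ?expR_gt0 ?stieltjes_den_gt0.
Qed.

(** Since x |-> x^q is a positive mixture of the functions x |-> x / (x + u),
    an inequality between sums that holds for each of these rational functions
    passes to the power. *)
Lemma le_sum_powR q (xs ys : seq R) : 0 < q < 1 ->
  all (<=%R 0) xs -> all (<=%R 0) ys ->
  (forall u, 0 < u ->
     \sum_(x <- xs) x / (x + u) <= \sum_(x <- ys) x / (x + u)) ->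
  \sum_(x <- xs) x `^ q <= \sum_(x <- ys) x `^ q.
Proof.
move=> q01 xs0 ys0 xys.
rewrite -(ler_pM2r (Rintegral_stieltjes1_gt0 _ q01)) -!Rintegral_sum_stieltjes//.
apply: le_Rintegral => //; [exact: integrable_sum_stieltjes..|].
move=> y _.
under eq_bigr do rewrite stieltjesE.
under [leRHS]eq_bigr do rewrite stieltjesE.
by rewrite -!mulr_sumr ler_pM2l ?expR_gt0// xys// expR_gt0.
Qed.

(** Strictness survives the mixture because the difference of the two
    integrands is positive everywhere. *)
Lemma lt_sum_powR q (xs ys : seq R) : 0 < q < 1 ->
  all (<=%R 0) xs -> all (<=%R 0) ys ->
  (forall u, 0 < u ->
     \sum_(x <- xs) x / (x + u) < \sum_(x <- ys) x / (x + u)) ->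
  \sum_(x <- xs) x `^ q < \sum_(x <- ys) x `^ q.
Proof.
move=> q01 xs0 ys0 xys.
rewrite -(ltr_pM2r (Rintegral_stieltjes1_gt0 _ q01)) -!Rintegral_sum_stieltjes//.
have ixs := integrable_sum_stieltjes _ _ q01 xs0.
have iys := integrable_sum_stieltjes _ _ q01 ys0.
rewrite -subr_gt0 -RintegralB//.
apply: Rintegral_gt0; first exact: (integrableB _ iys ixs).
move=> y; rewrite subr_gt0.
under eq_bigr do rewrite stieltjesE.
under [ltRHS]eq_bigr do rewrite stieltjesE.
by rewrite -!mulr_sumr ltr_pM2l ?expR_gt0// xys// expR_gt0.
Qed.

End stieltjes.

(** * Chords of the unit circle and Chebyshev iterates *)

Section circle_points.
Context {R : realType}.
Implicit Types (z w : R[i]) (c : R) (n : nat).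

(** The scalar product of the plane.  For two points of the circle it is the
    cosine of their angle, so the squared chord is [2 - 2 * inner z w]. *)
Definition inner z w : R :=
  complex.Re z * complex.Re w + complex.Im z * complex.Im w.

Lemma circleE z : circle z = (complex.Re z ^+ 2 + complex.Im z ^+ 2 = 1) :> Prop.
Proof.
rewrite /circle /=; apply/propext; case: z => x y /=.
split => [h|->]; last by rewrite sqrtr1.
rewrite -[LHS]sqr_sqrtr ?h ?expr1n//.
by rewrite addr_ge0// sqr_ge0.
Qed.

Lemma circleN z : circle z -> circle (- z).
Proof. by rewrite !circleE; case: z => x y /=; rewrite !sqrrN. Qed.

Lemma circleX z n : circle z -> circle (z ^+ n).
Proof.
move=> cz; elim: n => [|n IH].
  by rewrite circleE expr0 /=; ring.
move: IH cz; rewrite exprS !circleE.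
case: (z ^+ n) => a b; case: z => x y /= h1 h2.
transitivity ((x ^+ 2 + y ^+ 2) * (a ^+ 2 + b ^+ 2)); first ring.
by rewrite h1 h2 mulr1.
Qed.

Lemma inner_ge z w : circle z -> circle w -> -1 <= inner z w.
Proof.
rewrite !circleE /inner; case: z => x y; case: w => a b /= h1 h2.
have := sqr_ge0 (x + a); have := sqr_ge0 (y + b); nra.
Qed.

Lemma inner_le z w : circle z -> circle w -> inner z w <= 1.
Proof.
rewrite !circleE /inner; case: z => x y; case: w => a b /= h1 h2.
have := sqr_ge0 (x - a); have := sqr_ge0 (y - b); nra.
Qed.

Lemma inner_eqN1 z w : circle z -> circle w -> inner z w = -1 -> z = - w.
Proof.
rewrite !circleE /inner; case: z => x y; case: w => a b /= h1 h2 h.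
have e : (x + a) ^+ 2 + (y + b) ^+ 2 = 0.
  transitivity ((x ^+ 2 + y ^+ 2) + (a ^+ 2 + b ^+ 2) + 2 * (x * a + y * b)).
    ring.
  by rewrite h1 h2 h; ring.
move/eqP: e; rewrite paddr_eq0 ?sqr_ge0// !sqrf_eq0 !addr_eq0.
by move=> /andP[/eqP -> /eqP ->].
Qed.

Lemma innerNr z w : inner z (- w) = - inner z w.
Proof. by rewrite /inner; case: z => x y; case: w => a b /=; ring. Qed.

Lemma innerNl z w : inner (- z) w = - inner z w.
Proof. by rewrite /inner; case: z => x y; case: w => a b /=; ring. Qed.

Lemma inner_id z : circle z -> inner z z = 1.
Proof. by rewrite circleE /inner !expr2. Qed.

(** Squaring doubles the angle: cos(2t) = 2 cos(t)^2 - 1. *)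
Lemma inner_sqr z w : circle z -> circle w ->
  inner (z ^+ 2) (w ^+ 2) = 2 * inner z w ^+ 2 - 1.
Proof.
rewrite !circleE /inner !expr2; case: z => x y; case: w => a b /= h1 h2.
transitivity (2 * (x * a + y * b) ^+ 2 - (x * x + y * y) * (a * a + b * b)).
  ring.
by rewrite h1 h2 mulr1 expr2.
Qed.

Lemma riesz_kernelE s z w : circle z -> circle w ->
  riesz_kernel s z w = (2 - 2 * inner z w) `^ (- s / 2).
Proof.
rewrite !circleE /inner /riesz_kernel; case: z => x y; case: w => a b /= h1 h2.
have e : 2 - 2 * (x * a + y * b) = (x - a) ^+ 2 + (y - b) ^+ 2.
  transitivity ((x ^+ 2 + y ^+ 2) + (a ^+ 2 + b ^+ 2) - 2 * (x * a + y * b)).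
    by rewrite h1 h2; ring.
  ring.
rewrite e -powR12_sqrt ?addr_ge0 ?sqr_ge0// -powRrM.
by congr powR; rewrite mulrC.
Qed.

Lemma riesz_kernelC s z w : riesz_kernel s z w = riesz_kernel s w z.
Proof.
rewrite /riesz_kernel; congr powR; case: z => x y; case: w => a b /=.
by rewrite -(sqrrN (x - a)) -(sqrrN (y - b)) !opprB.
Qed.

Lemma riesz_kernelzz s z : s < 0 -> riesz_kernel s z z = 0.
Proof.
move=> s0; rewrite /riesz_kernel subrr; case: z => x y /=.
by rewrite expr0n/= addr0 sqrtr0 powR0// oppr_eq0 lt_eqF.
Qed.

(** The Chebyshev polynomial of degree 2^n, as an iterate of the one of
    degree 2. *)
Definition cheb n c : R := iter n (fun x => 2 * x ^+ 2 - 1) c.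

(** The numerator produced by summing 1 / (c - cos) over 2^n equally spaced
    angles: each doubling of the number of points contributes one factor. *)
Definition chebprod n c : R := \prod_(k < n) (4 * cheb k c).

Lemma cheb_ge n c : 1 < c -> 1 + 4 ^+ n * (c - 1) <= cheb n c.
Proof.
move=> c1; elim: n => [|n IH]; first by rewrite expr0 mul1r subrKC.
rewrite /= -/(cheb n c) exprS.
have h : 0 <= 4 ^+ n * (c - 1).
  by rewrite mulr_ge0 ?exprn_ge0// subr_ge0 ltW.
nra.
Qed.

Lemma cheb_gt1 n c : 1 < c -> 1 < cheb n c.
Proof.
move=> c1; apply: lt_le_trans (cheb_ge n c c1).
by rewrite ltrDl mulr_gt0// ?subr_gt0// exprn_gt0.
Qed.

Lemma chebprodS n c : chebprod n.+1 c = chebprod n c * (4 * cheb n c).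
Proof. by rewrite /chebprod big_ord_recr. Qed.

Lemma chebprod_gt0 n c : 1 < c -> 0 < chebprod n c.
Proof.
move=> c1; apply: prodr_gt0 => k _.
by rewrite mulr_gt0// (lt_trans _ (cheb_gt1 k c c1)).
Qed.

(** The left-hand side is the oscillation over the circle of the potential of
    2^n equally spaced points for the kernel x / (x + u), with x the squared
    chord and u = 2 (c - 1).  Comparing it with one extra term of that same
    shape, at a squared chord of order 4^(-n), is what lets the bound pass to
    powers. *)
Lemma cheb_gap n c : 1 < c ->
  2 * (c - 1) * chebprod n c / (cheb n c ^+ 2 - 1) <=
  8 / 4 ^+ n / (8 / 4 ^+ n + 2 * (c - 1)).
Proof.
move=> c1.
have C1 k := cheb_gt1 k c c1.
have D k : 0 < cheb k c ^+ 2 - 1 by have := C1 k; nra.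
(* g k.+1 = g k / cheb k c and g k <= 1, hence g k.+1 <= 1 / cheb k c, which
   the linear lower bound on cheb controls *)
pose g k := 2 * (c - 1) * chebprod k c / (cheb k c ^+ 2 - 1).
have gS k : g k.+1 = g k / cheb k c.
  rewrite /g chebprodS.
  have -> : cheb k.+1 c ^+ 2 - 1 = 4 * cheb k c ^+ 2 * (cheb k c ^+ 2 - 1).
    by rewrite /cheb /=; ring.
  have := C1 k; have := D k; set C := cheb k c => D0 C0.
  by field; rewrite !gt_eqF// (lt_trans _ C0).
have g0E : g 0%N = 2 / (c + 1).
  rewrite /g /chebprod big_ord0 /cheb /=.
  have -> : c ^+ 2 - 1 = (c - 1) * (c + 1) by ring.
  by field; rewrite !gt_eqF// ?subr_gt0// addr_gt0// (lt_trans _ c1).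
have g1 k : g k <= 1.
  elim: k => [|k IH]; first by rewrite g0E ler_pdivrMr; lra.
  rewrite gS ler_pdivrMr ?(lt_trans _ (C1 k))// mul1r.
  exact/(le_trans IH)/ltW.
rewrite -/(g n); case: n => [|n].
  rewrite g0E expr0 divr1.
  have -> : 8 / (8 + 2 * (c - 1)) = 4 / (c + 3).
    by field; rewrite !gt_eqF//; lra.
  rewrite ler_pdivrMr; last lra.
  by rewrite mulrAC ler_pdivlMr; lra.
have h : 0 < 4 ^+ n :> R by rewrite exprn_gt0.
have h2 : 0 < 4 ^+ n * (c - 1) by rewrite mulr_gt0// subr_gt0.
have -> : 8 / 4 ^+ n.+1 / (8 / 4 ^+ n.+1 + 2 * (c - 1)) =
    (1 + 4 ^+ n * (c - 1))^-1 :> R.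
  rewrite exprS; move: (4 ^+ n) h h2 => t h h2.
  field.
  by rewrite !gt_eqF//; lra.
rewrite gS (@le_trans _ _ (cheb n c)^-1)//.
  by rewrite ler_pdivrMr ?mulVf ?g1// ?gt_eqF// (lt_trans _ (C1 n)).
rewrite lef_pV2 ?posrE ?cheb_ge// ?(lt_trans _ (C1 n))//.
by rewrite addr_gt0.
Qed.

End circle_points.

(** * Potentials of complete systems of roots *)

Section root_systems.
Context {R : realType}.
Implicit Types (a : nat -> R[i]) (z w : R[i]) (c : R) (n : nat).

(** The first 2^n terms of [a] are the 2^n-th roots of some point of the circle.
    Rather than asking for an enumeration of these roots, the last clause records
    the one identity that gets used, which is a closed form for the sum of
    1 / (c - cos) over 2^n equally spaced angles. *)
Definition root_system n a :=
  [/\ forall l, (l < 2 ^ n)%N -> circle (a l),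
      forall l, (l < 2 ^ n)%N -> a l ^+ (2 ^ n) = a 0%N ^+ (2 ^ n) &
      forall c z, 1 < c -> circle z ->
        \sum_(l < 2 ^ n) (c - inner z (a l))^-1 =
        chebprod n c / (cheb n c - inner (z ^+ (2 ^ n)) (a 0%N ^+ (2 ^ n)))].

Lemma root_system0 a : circle (a 0%N) -> root_system 0 a.
Proof.
move=> ca; split.
- by move=> l; rewrite expn0 ltnS leqn0 => /eqP ->.
- by move=> l; rewrite expn0 ltnS leqn0 => /eqP ->.
- move=> c z c1 cz; rewrite expn0 big_ord1 /chebprod big_ord0 div1r.
  by rewrite !expr1.
Qed.

(** The 2^n-th roots of w and of -w together are the 2^(n+1)-th roots of w^2,
    and 1 / (C - x) + 1 / (C + x) = 4 C / ((2 C^2 - 1) - (2 x^2 - 1)). *)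
Lemma root_systemS n a :
  root_system n a -> root_system n (fun l => a (2 ^ n + l)%N) ->
  a (2 ^ n)%N ^+ (2 ^ n) = - a 0%N ^+ (2 ^ n) -> root_system n.+1 a.
Proof.
move=> [ca aw sa] [cb bw sb] aN.
rewrite /= addn0 in bw sb.
have e2n : (2 ^ n.+1 = 2 ^ n + 2 ^ n)%N by rewrite expnS mul2n addnn.
have split_lt l : (l < 2 ^ n.+1)%N ->
    (l < 2 ^ n)%N \/ exists2 k, (k < 2 ^ n)%N & l = (2 ^ n + k)%N.
  rewrite e2n => lt; have [ll|ll] := ltnP l (2 ^ n); first by left.
  by right; exists (l - 2 ^ n)%N; [rewrite ltn_subLR|rewrite subnKC].
have pS z : z ^+ (2 ^ n.+1) = (z ^+ (2 ^ n)) ^+ 2.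
  by rewrite -exprM expnSr.
have c0 : circle (a 0%N) by apply: ca; rewrite expn_gt0.
split.
- by move=> l /split_lt[/ca//|[k k2 ->]]; exact: cb.
- move=> l /split_lt[/aw e|[k k2 ->]]; first by rewrite !pS e.
  by rewrite !pS bw// aN sqrrN.
- move=> c z c1 cz; rewrite e2n big_split_ord /= sa// sb// -e2n !pS aN innerNr.
  rewrite (inner_sqr _ _ (circleX _ _ cz) (circleX _ _ c0)) chebprodS /= -/(cheb n c) opprK.
  have C1 := cheb_gt1 n c c1.
  have := inner_ge (z ^+ (2 ^ n)) (a 0%N ^+ (2 ^ n)) (circleX _ _ cz) (circleX _ _ c0).
  have := inner_le (z ^+ (2 ^ n)) (a 0%N ^+ (2 ^ n)) (circleX _ _ cz) (circleX _ _ c0).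
  move: C1; set C := cheb n c; set x := inner _ _; move=> C1 x1 x2.
  have h1 : 0 < C - x by lra.
  have h2 : 0 < C + x by lra.
  have -> : 2 * C ^+ 2 - 1 - (2 * x ^+ 2 - 1) = 2 * ((C - x) * (C + x)) by ring.
  by field; rewrite !gt_eqF.
Qed.

Lemma root_system_circle_pow n a : root_system n a ->
  circle (a 0%N ^+ (2 ^ n)).
Proof. by move=> [ca _ _]; apply/circleX/ca; rewrite expn_gt0. Qed.

Definition sq_chords a N z : seq R :=
  [seq 2 - 2 * inner z (a l) | l <- iota 0 N].

Lemma sq_chords_ge0 a N z : (forall l, (l < N)%N -> circle (a l)) -> circle z ->
  all (<=%R 0) (sq_chords a N z).
Proof.
move=> ca cz; apply/allP => _ /mapP[l + ->]; rewrite mem_iota add0n => lN.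
by have := inner_le _ _ cz (ca _ lN) => /=; lra.
Qed.

Lemma potentialE s a N z : (forall l, (l < N)%N -> circle (a l)) -> circle z ->
  potential s a N z = \sum_(x <- sq_chords a N z) x `^ (- s / 2).
Proof.
move=> ca cz; rewrite /potential /sq_chords big_map.
rewrite (_ : iota 0 N = index_iota 0 N); last by rewrite /index_iota subn0.
by rewrite big_mkord; apply: eq_bigr => l _; rewrite riesz_kernelE//; exact: ca.
Qed.

Lemma sq_chords_root_system n a z c : root_system n a -> circle z -> 1 < c ->
  \sum_(x <- sq_chords a (2 ^ n) z) x / (x + 2 * (c - 1)) =
  (2 ^ n)%:R - (c - 1) * (chebprod n c /
    (cheb n c - inner (z ^+ (2 ^ n)) (a 0%N ^+ (2 ^ n)))).
Proof.
move=> [ca aw sa] cz c1; rewrite -sa//.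
rewrite /sq_chords big_map.
rewrite (_ : iota 0 _ = index_iota 0 (2 ^ n)); last first.
  by rewrite /index_iota subn0.
rewrite big_mkord mulr_sumr -[X in _ = X%:R - _]card_ord -sumr_const -sumrB.
apply: eq_bigr => l _.
have := inner_le z (a l) cz (ca _ (ltn_ord l)); set x := inner _ _ => x1.
field; apply/andP; split; rewrite gt_eqF//; lra.
Qed.

Section exponent.
Variables (s : R) (hs : -2 < s < 0).

Let q01 : 0 < - s / 2 < 1. Proof. by case/andP: hs; lra. Qed.

Let u_half (u : R) : 0 < u -> exists2 c, 1 < c & u = 2 * (c - 1).
Proof. by move=> u0; exists (1 + u / 2); lra. Qed.

(** The potential of a complete system of roots of w is strictly decreasing in
    the cosine of the angle between z^(2^n) and w: this is clear from the closed
    form for the kernels x / (x + u), and passes to the power. *)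
Lemma root_potential_lt n a z z' : root_system n a -> circle z -> circle z' ->
  inner (z' ^+ (2 ^ n)) (a 0%N ^+ (2 ^ n)) <
  inner (z ^+ (2 ^ n)) (a 0%N ^+ (2 ^ n)) ->
  potential s a (2 ^ n) z < potential s a (2 ^ n) z'.
Proof.
move=> ra cz cz' zz'; have [ca _ _] := ra.
have c0 := root_system_circle_pow n a ra.
rewrite !potentialE//; apply: lt_sum_powR => //; [exact: sq_chords_ge0..|].
move=> _ /u_half[c c1 ->]; rewrite !sq_chords_root_system//.
rewrite ltrD2l ltrN2 ltr_pM2l ?subr_gt0// ltr_pM2l ?chebprod_gt0//.
have C1 := cheb_gt1 n c c1.
have := inner_le _ _ (circleX _ (2 ^ n) cz) c0.
have := inner_le _ _ (circleX _ (2 ^ n) cz') c0.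
by move=> ? ?; rewrite ltf_pV2 ?posrE; lra.
Qed.

Lemma root_potential_le n a z z' : root_system n a -> circle z -> circle z' ->
  inner (z' ^+ (2 ^ n)) (a 0%N ^+ (2 ^ n)) <=
  inner (z ^+ (2 ^ n)) (a 0%N ^+ (2 ^ n)) ->
  potential s a (2 ^ n) z <= potential s a (2 ^ n) z'.
Proof.
move=> ra cz cz' zz'; have [ca _ _] := ra.
have c0 := root_system_circle_pow n a ra.
rewrite !potentialE//; apply: le_sum_powR => //; [exact: sq_chords_ge0..|].
move=> _ /u_half[c c1 ->]; rewrite !sq_chords_root_system//.
rewrite lerD2l lerN2 ler_pM2l ?subr_gt0// ler_pM2l ?chebprod_gt0//.
have C1 := cheb_gt1 n c c1.
have := inner_le _ _ (circleX _ (2 ^ n) cz) c0.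
have := inner_le _ _ (circleX _ (2 ^ n) cz') c0.
by move=> ? ?; rewrite lef_pV2 ?posrE; lra.
Qed.

(** By [cheb_gap] the oscillation for each kernel x / (x + u) is at most the
    value of that kernel at one extra squared chord 8 / 4^n. *)
Lemma root_potential_gap n a z z' : root_system n a -> circle z -> circle z' ->
  potential s a (2 ^ n) z' <= potential s a (2 ^ n) z + (8 / 4 ^+ n) `^ (- s / 2).
Proof.
move=> ra cz cz'; have [ca _ _] := ra.
have c0 := root_system_circle_pow n a ra.
rewrite !potentialE// addrC.
rewrite -(big_cons _ _ _ _ xpredT (fun x => x `^ (- s / 2))).
apply: le_sum_powR => //=; [exact: sq_chords_ge0| |].
  by rewrite sq_chords_ge0// andbT divr_ge0 ?exprn_ge0.
move=> _ /u_half[c c1 ->]; rewrite big_cons !sq_chords_root_system//.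
have C1 := cheb_gt1 n c c1.
have P0 := chebprod_gt0 n c c1.
have := cheb_gap n c c1.
have := inner_le _ _ (circleX _ (2 ^ n) cz) c0.
have := inner_ge _ _ (circleX _ (2 ^ n) cz') c0.
have := inner_le _ _ (circleX _ (2 ^ n) cz') c0.
set x' := inner _ _; set x := inner _ _; set g := 8 / _ / _.
move: C1 P0; set C := cheb n c; set P := chebprod n c => C1 P0 x'1 x'N1 x1 hg.
(* the extreme values of the potential are those at cosines 1 and -1 *)
have d1 : (c - 1) * (P / (C + 1)) <= (c - 1) * (P / (C - x')).
  rewrite ler_pM2l ?subr_gt0// ler_pM2l// lef_pV2 ?posrE; lra.
have d2 : (c - 1) * (P / (C - x)) <= (c - 1) * (P / (C - 1)).
  rewrite ler_pM2l ?subr_gt0// ler_pM2l// lef_pV2 ?posrE; lra.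
have d3 : (c - 1) * (P / (C - 1)) - (c - 1) * (P / (C + 1)) =
    2 * (c - 1) * P / (C ^+ 2 - 1).
  have -> : C ^+ 2 - 1 = (C - 1) * (C + 1) by ring.
  by field; rewrite !gt_eqF//; lra.
by lra.
Qed.

End exponent.
End root_systems.

(** * Binary structure of greedy sequences *)

Section greedy_structure.
Context {R : realType}.
Implicit Types (a : nat -> R[i]) (z w : R[i]) (n N r : nat).

Lemma circle_root n w : circle w -> exists2 z, circle z & z ^+ (2 ^ n) = w.
Proof.
move=> cw; have n0 : (0 < 2 ^ n)%N by rewrite expn_gt0.
exists ((2 ^ n).-root w); last by rewrite rootCK.
have w1 : `|w| = 1 by rewrite normc_def; move: cw; rewrite /circle /= => cw; case: (w) cw => x y /= ->.
have /eqP : `|(2 ^ n).-root w| ^+ (2 ^ n) = 1 by rewrite -normrX rootCK.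
rewrite pexprn_eq1 ?expn_gt0// eqn0Ngt n0 /= => /eqP.
by rewrite normc_def /circle /=; case: (_.-root _) => x y /= [].
Qed.

Definition tail_from a N : nat -> R[i] := fun l => a (N + l)%N.

(** A finite form of the greedy property: the structure is proved by induction
    on blocks of the sequence, which are greedy only over a bounded length. *)
Definition greedy_upto s a N :=
  (forall l, (l < N)%N -> circle (a l)) /\
  (forall l, (0 < l < N)%N -> forall z, circle z ->
     potential s a l z <= potential s a l (a l)).

Lemma potentialD s a N r z :
  potential s a (N + r) z = potential s a N z + potential s (tail_from a N) r z.
Proof. by rewrite /potential big_split_ord. Qed.

Lemma potential0 s a z : potential s a 0 z = 0.
Proof. by rewrite /potential big_ord0. Qed.

Lemma greedy_uptoW s a N N' : (N' <= N)%N -> greedy_upto s a N ->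
  greedy_upto s a N'.
Proof.
move=> NN' [ca ga]; split => [l lN|l /andP[l0 lN]].
  exact: ca (leq_trans lN NN').
by apply: ga; rewrite l0 (leq_trans lN NN').
Qed.

Section exponent.
Variables (s : R) (hs : -2 < s < 0).

Lemma root_potential_max n a z z' : root_system n a -> circle z -> circle z' ->
  z ^+ (2 ^ n) = - a 0%N ^+ (2 ^ n) ->
  potential s a (2 ^ n) z' <= potential s a (2 ^ n) z.
Proof.
move=> ra cz cz' zw; have c0 := root_system_circle_pow n a ra.
apply: (root_potential_le _ hs) => //.
by rewrite zw innerNl inner_id// inner_ge//; exact: circleX.
Qed.

(** The potential of a root system has no maximizers other than the midpoints
    of the arcs between consecutive roots. *)
Lemma root_potential_max_eq n a z z' : root_system n a -> circle z ->
  circle z' -> z ^+ (2 ^ n) = - a 0%N ^+ (2 ^ n) ->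
  potential s a (2 ^ n) z <= potential s a (2 ^ n) z' ->
  z' ^+ (2 ^ n) = - a 0%N ^+ (2 ^ n).
Proof.
move=> ra cz cz' zw zz'; have c0 := root_system_circle_pow n a ra.
apply: inner_eqN1 => //; first exact: circleX.
apply/eqP; rewrite eq_le inner_ge ?andbT//; last exact: circleX.
rewrite leNgt; apply/negP => lt.
suff : potential s a (2 ^ n) z' < potential s a (2 ^ n) z by rewrite ltNge zz'.
apply: (root_potential_lt _ hs) => //.
by rewrite zw innerNl inner_id.
Qed.

(** What the induction on n carries.  The first two clauses are the description
    sought.  The third one, that an incomplete system has a best next point among
    the missing roots, is what forces the second block of 2^n points to stay on
    the midpoints left by the first block. *)
Definition binary_structure n :=
  [/\ forall a N, (N <= 2 ^ n)%N -> greedy_upto s a N ->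
        forall l, (l < N)%N -> a l ^+ (2 ^ n) = a 0%N ^+ (2 ^ n),
      forall a, greedy_upto s a (2 ^ n) -> root_system n a &
      forall a N, (0 < N < 2 ^ n)%N -> greedy_upto s a N ->
        exists z, [/\ circle z, z ^+ (2 ^ n) = a 0%N ^+ (2 ^ n) &
          forall z', circle z' -> potential s a N z' <= potential s a N z]].

(** The potential seen by the points of the second block is the sum of the
    potential of the complete first block and of the potential of the part of
    the second block already present.  Some point maximizes both summands at once,
    so every maximizer of the sum maximizes both. *)
Lemma greedy_tail_of_structure n a r : binary_structure n -> (r <= 2 ^ n)%N ->
  greedy_upto s a (2 ^ n + r) ->
  greedy_upto s (tail_from a (2 ^ n)) r /\
  (forall l, (l < r)%N -> tail_from a (2 ^ n) l ^+ (2 ^ n) = - a 0%N ^+ (2 ^ n)).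
Proof.
move=> [_ Bn Cn]; elim: r => [|r IH] rn ga.
  by split => //; split => // l; rewrite ltn0 andbF.
have [|gb bw] := IH (ltnW rn); first by apply: greedy_uptoW ga; rewrite addnS.
have ra : root_system n a by apply/Bn/(greedy_uptoW _ _ _ _ _ ga)/leq_addr.
have [ca amax] := ga.
have cb : circle (tail_from a (2 ^ n) r) by apply: ca; rewrite ltn_add2l.
have c0 := root_system_circle_pow n a ra.
have {}amax z : circle z ->
    potential s a (2 ^ n + r) z <= potential s a (2 ^ n + r) (tail_from a (2 ^ n) r).
  by apply: amax; rewrite addn_gt0 expn_gt0 ltn_add2l ltnSn.
have [z [cz zw zmax]] : exists z, [/\ circle z,
    z ^+ (2 ^ n) = - a 0%N ^+ (2 ^ n) &
    forall z', circle z' ->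
      potential s (tail_from a (2 ^ n)) r z' <= potential s (tail_from a (2 ^ n)) r z].
  (* the first point of the block sees no other point of it *)
  case: (posnP r) => [r0|r0].
    have [z cz zw] := circle_root n _ (circleN _ c0).
    by exists z; split => // z' _; rewrite r0 !potential0.
  have [|z [cz zw zmax]] := Cn _ r _ gb; first by rewrite r0.
  by exists z; split => //; rewrite zw bw.
have h1 := amax z cz; rewrite !potentialD in h1.
have h2 := zmax _ cb.
have h3 := root_potential_max n a _ _ ra cz cb zw.
have brw : tail_from a (2 ^ n) r ^+ (2 ^ n) = - a 0%N ^+ (2 ^ n).
  by apply: (root_potential_max_eq n a z) => //; lra.
split; last first.
  by move=> l; rewrite ltnS leq_eqVlt => /predU1P[->//|]; exact: bw.
have [cb' bmax] := gb; split.
  by move=> l; rewrite ltnS leq_eqVlt => /predU1P[->//|]; exact: cb'.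
move=> l /andP[l0]; rewrite ltnS leq_eqVlt => /predU1P[->|lr].
  move=> z' cz'; apply: le_trans (zmax _ cz') _; lra.
by apply: bmax; rewrite l0.
Qed.

Lemma greedy_binary_structure n : binary_structure n.
Proof.
elim: n => [|n IH].
  split => //.
  - by move=> a N; rewrite expn0 => N1 _ l lN; case: l lN => // l lN;
      have := leq_trans lN N1.
  - by move=> a [ca _]; apply/root_system0/ca.
  - by move=> a N; rewrite expn0 ltnS; case: N.
have [An Bn Cn] := IH.
have pS z : z ^+ (2 ^ n.+1) = (z ^+ (2 ^ n)) ^+ 2 by rewrite -exprM expnSr.
have e2n : (2 ^ n.+1 = 2 ^ n + 2 ^ n)%N by rewrite expnS mul2n addnn.
have A' a N : (N <= 2 ^ n.+1)%N -> greedy_upto s a N ->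
    forall l, (l < N)%N -> a l ^+ (2 ^ n.+1) = a 0%N ^+ (2 ^ n.+1).
  move=> N2 ga l lN; rewrite !pS.
  have [N2'|N2'] := leqP N (2 ^ n); first by rewrite (An _ _ _ ga).
  have [l2|l2] := ltnP l (2 ^ n).
    by rewrite (An a _ (leqnn _) (greedy_uptoW _ _ _ _ (ltnW N2') ga)).
  have [||_ /(_ (l - 2 ^ n)%N)] := greedy_tail_of_structure n a (N - 2 ^ n) IH.
  - by rewrite leq_subLR -e2n.
  - by rewrite subnKC// ltnW.
  - by rewrite /tail_from subnKC// ltn_sub2r// => /(_ isT) ->; rewrite sqrrN.
split => //.
- move=> a; rewrite e2n => ga.
  have [gb bw] := greedy_tail_of_structure n a _ IH (leqnn _) ga.
  apply: root_systemS; [|exact: Bn|].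
  + by apply/Bn/(greedy_uptoW _ _ _ _ _ ga)/leq_addr.
  + by have := bw 0%N; rewrite /tail_from addn0; apply; rewrite expn_gt0.
- move=> a N /andP[N0 N2] ga; rewrite pS.
  have [N2'|] := ltnP N (2 ^ n).
    have [|z [cz zw zmax]] := Cn a N _ ga; first by rewrite N0.
    by exists z; split => //; rewrite pS zw.
  move=> N2'; pose r := (N - 2 ^ n)%N.
  have rN : N = (2 ^ n + r)%N by rewrite subnKC.
  have r2 : (r < 2 ^ n)%N by rewrite ltn_subLR// -e2n.
  rewrite rN in ga.
  have ra : root_system n a by apply/Bn/(greedy_uptoW _ _ _ _ _ ga)/leq_addr.
  have c0 := root_system_circle_pow n a ra.
  have [gb bw] := greedy_tail_of_structure n a r IH (ltnW r2) ga.
  case: (posnP r) => [r0|r0].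
    have [z cz zw] := circle_root n _ (circleN _ c0).
    exists z; split => //; first by rewrite pS zw sqrrN.
    move=> z' cz'; rewrite rN r0 addn0.
    exact: root_potential_max.
  have [|z [cz zw zmax]] := Cn _ r _ gb; first by rewrite r0.
  rewrite bw// in zw.
  exists z; split => //; first by rewrite pS zw sqrrN.
  move=> z' cz'; rewrite rN !potentialD lerD ?zmax//.
  exact: root_potential_max.
Qed.

Lemma greedy_root_system n a : greedy_upto s a (2 ^ n) -> root_system n a.
Proof. by have [_ + _] := greedy_binary_structure n; apply. Qed.

Lemma greedy_tail n a r : (r <= 2 ^ n)%N -> greedy_upto s a (2 ^ n + r) ->
  greedy_upto s (tail_from a (2 ^ n)) r.
Proof.
by move=> rn /(greedy_tail_of_structure _ _ _ (greedy_binary_structure n) rn)[].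
Qed.

End exponent.
End greedy_structure.

(** * Averages over the circle *)

Section circle_average.
Context {R : realType}.
Implicit Types (z w : R[i]) (s t c : R).
Notation mu := (@lebesgue_measure R).

Lemma continuous_Lipschitz_complex (f : R[i] -> R) :
  (forall z w, `|f z - f w|%:C <= `|z - w|)%C ->
  continuous (f : (R[i])^o -> R).
Proof.
move=> fL z.
have Fz : Filter (nbhs (z : (R[i])^o)) by exact: nbhs_filter.
apply/(@cvgrPdist_lt R R (R[i])^o _ Fz) => e e0.
exists e%:C%C => [|w /= zw]; first by rewrite /= ltcR.
by rewrite -ltcR; exact: le_lt_trans (fL z w) zw.
Qed.

Lemma measurable_continuous_complex (f : R[i] -> R) :
  continuous (f : (R[i])^o -> R) ->
  measurable_fun [set: borelC R] (f : borelC R -> R).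
Proof.
move=> cf; apply: (measurability _ (RGenOpens.measurableE R)).
move=> _ [_ [a [b ->] <-]]; rewrite setTI.
apply: sub_sigma_algebra; apply: (open_comp _ (itv_open _ _)).
by move=> z _; exact: cf.
Qed.

Lemma measurable_Re : measurable_fun [set: borelC R] (@complex.Re R : borelC R -> R).
Proof.
apply: measurable_continuous_complex.
apply: continuous_Lipschitz_complex => z w.
rewrite -raddfB; exact: normc_ge_Re.
Qed.

Lemma measurable_Im : measurable_fun [set: borelC R] (@complex.Im R : borelC R -> R).
Proof.
apply: measurable_continuous_complex.
apply: continuous_Lipschitz_complex => z w.
rewrite -raddfB normc_def lecR -sqrtr_sqr ler_wsqrtr//.
by rewrite lerDr sqr_ge0.
Qed.

Lemma measurable_circle : measurable (circle : set (borelC R)).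
Proof.
have mf : measurable_fun [set: borelC R]
    (fun z : borelC R => complex.Re z ^+ 2 + complex.Im z ^+ 2 : R).
  apply: measurable_funD; apply: measurable_funX.
    exact: measurable_Re.
  exact: measurable_Im.
rewrite (_ : circle = setT `&` (fun z : borelC R =>
    complex.Re z ^+ 2 + complex.Im z ^+ 2 : R) @^-1` [set 1]).
  by apply: mf => //; exact: measurable_set1.
by rewrite setTI; apply/seteqP; split => z /=; rewrite circleE.
Qed.

Lemma measurable_riesz_kernel s z : circle z ->
  measurable_fun (circle : set (borelC R))
    (fun w : borelC R => (riesz_kernel s z w)%:E).
Proof.
move=> cz; apply/measurable_EFinP.
apply: (eq_measurable_fun
  (fun w : borelC R => (2 - 2 * inner z w) `^ (- s / 2))).
  by move=> w; rewrite inE => cw; rewrite riesz_kernelE.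
apply: (@measurable_funTS _ _ (borelC R)).
apply: (measurableT_comp (measurable_powR (- s / 2))).
apply: measurable_funB => //; apply: measurable_funM => //.
apply: measurable_funD; apply: measurable_funM => //.
  exact: measurable_Re.
exact: measurable_Im.
Qed.

Lemma circle_expi t : circle (expi t).
Proof. by rewrite circleE /= cos2Dsin2. Qed.

Lemma expi_surj z : circle z -> exists2 t, 0 <= t <= 2 * pi & z = expi t.
Proof.
rewrite circleE; case: z => x y /= h.
have xI : -1 <= x <= 1 by apply/andP; split; have := sqr_ge0 y; nra.
have t0 := acos_ge0 xI; have tpi := acos_lepi xI.
have cx : cos (acos x) = x by rewrite acosK.
have sy : sin (acos x) = `|y|.
  by rewrite sin_acos// -sqrtr_sqr; congr Num.sqrt; rewrite -h; ring.
have [y0|y0] := leP 0 y.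
  exists (acos x); first by apply/andP; split => //; have := pi_ge0 R; lra.
  by rewrite /expi cx sy ger0_norm.
exists (2 * pi - acos x); first by have := pi_ge0 R; lra.
rewrite /expi mulr_natl addrC cosD2pi sinD2pi cosN sinN cx sy.
by rewrite ltr0_norm// opprK.
Qed.

(** The kernel as a function of the angle t between the two points. *)
Definition chord_power s t : R := (2 - 2 * cos t) `^ (- s / 2).

Lemma riesz_kernel_expi s t c :
  riesz_kernel s (expi c) (expi t) = chord_power s (t - c).
Proof.
rewrite riesz_kernelE; [|exact: circle_expi..].
rewrite /chord_power cosB /inner /=; congr powR; ring.
Qed.

(** The absolute value matters: powR takes the value 1 at negative reals, so
    the power itself is discontinuous at 0. *)
Lemma continuous_powR_norm (q : R) : 0 < q ->
  continuous (fun x : R => `|x| `^ q).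
Proof.
move=> q0 x; have [->|x0] := eqVneq x 0.
  apply/cvgrPdist_lt => e e0; near=> w.
  rewrite normr0 powR0 ?gt_eqF// sub0r normrN ger0_norm ?powR_ge0//.
  have -> : e = (e `^ q^-1) `^ q by rewrite -powRrM mulVf ?gt_eqF// powRr1// ltW.
  rewrite gt0_ltr_powR// ?nnegrE ?powR_ge0//.
  rewrite -[w]subr0 distrC; near: w.
  by apply: cvgr_dist_lt; rewrite ?powR_gt0//; exact: cvg_id.
have x0' : 0 < `|x| by rewrite normr_gt0.
apply: (continuous_comp (f := fun x : R => `|x|) (g := fun x : R => x `^ q)).
  exact: norm_continuous.
apply/differentiable_continuous/derivable1_diffP.
by apply: derivable_powR; rewrite in_itv/= andbT.
Unshelve. all: by end_near. Qed.

Lemma continuous_chord_power s : s < 0 -> continuous (chord_power s).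
Proof.
move=> s0; rewrite (_ : chord_power s = fun t => `|2 - 2 * cos t| `^ (- s / 2)).
  move=> t; apply: (continuous_comp (f := fun t => 2 - 2 * cos t)
    (g := fun x : R => `|x| `^ (- s / 2))).
    apply: cvgB; first exact: cvg_cst.
    by apply: cvgM; [exact: cvg_cst|exact: continuous_cos].
  by apply: continuous_powR_norm; lra.
by apply/funext => t; rewrite ger0_norm.
Qed.

Lemma chord_powerD2pi s t : chord_power s (t + 2 * pi) = chord_power s t.
Proof. by rewrite /chord_power [2 * pi]mulr_natl cosD2pi. Qed.

Lemma Rintegral_translate (h : R -> R) a b c : a <= b -> continuous h ->
  \int[mu]_(t in `[a + c, b + c]) h t = \int[mu]_(t in `[a, b]) h (t + c).
Proof.
move=> ab ch.
have D1 : (fun t : R => t + c)^`()%classic = cst 1.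
  apply/funext => t; rewrite derive1E deriveD//.
  by rewrite derive_id derive_cst addr0.
rewrite /Rintegral.
rewrite (@integration_by_substitution_increasing R (fun t => t + c))//.
- congr fine; apply: eq_integral => t _; congr EFin.
  by rewrite D1 /= !fctE /= mulr1.
- by move=> u v _ _ uv; rewrite ltrD2r.
- by rewrite D1 => x _; exact: cst_continuous.
- by rewrite D1; exact: is_cvg_cst.
- by rewrite D1; exact: is_cvg_cst.
- have cF : continuous (fun t : R => t + c).
    by move=> t; apply: cvgD; [exact: cvg_id|exact: cvg_cst].
  split.
  + by move=> t _; exact: derivableD.
  + by apply: cvg_at_right_filter; exact: cF.
  + by apply: cvg_at_left_filter; exact: cF.
- exact: continuous_subspaceT.
Qed.

Lemma continuous_itv_integrable (h : R -> R) a b : continuous h ->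
  mu.-integrable `[a, b] (EFin \o h).
Proof.
move=> ch; apply: continuous_compact_integrable; first exact: segment_compact.
exact: continuous_subspaceT.
Qed.

Lemma Rintegral_split (h : R -> R) a b c : a <= c <= b -> continuous h ->
  \int[mu]_(t in `[a, b]) h t =
  \int[mu]_(t in `[a, c]) h t + \int[mu]_(t in `[c, b]) h t.
Proof.
move=> /andP[ac cb] ch.
have ih := continuous_itv_integrable h a b ch.
rewrite -(@Rintegral_itv_obnd_cbnd _ c); last first.
  apply: integrableS ih => //; apply: subset_itvr.
  by rewrite bnd_simp.
rewrite -(@Rintegral_itvB _ h (BLeft a) (BRight b) c)// ?bnd_simp//.
by rewrite addrC subrK.
Qed.

Lemma Rintegral_periodic (h : R -> R) p c : continuous h ->
  (forall t, h (t + p) = h t) -> 0 <= c <= p ->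
  \int[mu]_(t in `[0, p]) h (t - c) = \int[mu]_(t in `[0, p]) h t.
Proof.
move=> ch hp /andP[c0 cp].
have chc : continuous (fun t => h (t - c)).
  move=> t; apply: continuous_comp; last exact: ch.
  by apply: cvgB; [exact: cvg_id|exact: cvg_cst].
rewrite (Rintegral_split (fun t => h (t - c)) _ _ c) ?c0//.
rewrite (Rintegral_split h _ _ (p - c)) ?subr_ge0 ?cp ?gerBl// addrC.
congr (_ + _).
  rewrite -(Rintegral_translate h c p (- c))//.
  by rewrite subrr.
have -> : \int[mu]_(t in `[p - c, p]) h t =
    \int[mu]_(t in `[0 + (p - c), c + (p - c)]) h t by rewrite add0r subrKC.
rewrite Rintegral_translate//.
by apply: eq_Rintegral => t _; rewrite addrCA addrC hp.
Qed.

Lemma continuous_shift_chord_power s c : s < 0 ->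
  continuous (fun t => chord_power s (t - c)).
Proof.
move=> s0 t; apply: (continuous_comp (f := fun t => t - c)).
  by apply: cvgB; [exact: cvg_id|exact: cvg_cst].
exact: continuous_chord_power.
Qed.

Lemma Rintegral_shift_chord_power s c : s < 0 -> 0 <= c <= 2 * pi ->
  \int[mu]_(t in `[0, 2 * pi]) chord_power s (t - c) =
  \int[mu]_(t in `[0, 2 * pi]) chord_power s t.
Proof.
move=> s0 c2pi; apply: Rintegral_periodic => //.
  exact: continuous_chord_power.
exact: chord_powerD2pi.
Qed.

(** By rotation invariance the average of the kernel does not depend on z. *)
Lemma riesz_average s z : s < 0 -> circle z ->
  \int[sigma]_(w in circle) riesz_kernel s z w =
  (2 * pi)^-1 * \int[mu]_(t in `[0, 2 * pi]) chord_power s t.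
Proof.
move=> s0 cz; have [c c2pi zc] := expi_surj z cz.
rewrite -(Rintegral_shift_chord_power s c)// /Rintegral /sigma.
rewrite (@ge0_integral_pushforward _ _ _ _ _ _ (@measurable_expi R))/=; last 3 first.
- exact: measurable_circle.
- exact: measurable_riesz_kernel.
- by move=> w _; rewrite lee_fin powR_ge0.
rewrite (_ : @expi R @^-1` circle = setT); last first.
  by apply/seteqP; split => // t _; exact: circle_expi.
transitivity (fine (\int[uniform_prob (lt0_2pi R)]_t
    (chord_power s ((t : R) - c))%:E)).
  by congr fine; apply: eq_integral => t _; rewrite zc riesz_kernel_expi.
have cf := continuous_shift_chord_power s c s0.
rewrite integral_uniform/=; last 2 first.
- by apply/measurable_EFinP; exact: continuous_measurable_fun.
- by move=> t; rewrite lee_fin powR_ge0.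
rewrite subr0 fineM//; apply: integrable_fin_num => //.
exact: (continuous_itv_integrable (fun t => chord_power s (t - c))).
Qed.

Lemma energy_sigmaE s : s < 0 ->
  energy_sigma s = (2 * pi)^-1 * \int[mu]_(t in `[0, 2 * pi]) chord_power s t.
Proof.
move=> s0; rewrite /energy_sigma.
under eq_Rintegral => z do (rewrite inE => cz; rewrite (riesz_average _ _ s0 cz)).
rewrite Rintegral_cst; last exact: measurable_circle.
have preT : @expi R @^-1` circle = setT.
  by apply/seteqP; split => // t _; exact: circle_expi.
have sigma1 : sigma (circle : set (borelC R)) = 1%E.
  transitivity (uniform_prob (lt0_2pi R) (@expi R @^-1` circle)) => //.
  by rewrite preT probability_setT.
by rewrite [X in _ * X](_ : _ = 1) ?mulr1//; exact: (congr1 fine sigma1).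
Qed.

Lemma integral_potential s (a : nat -> R[i]) N : s < 0 ->
  (forall l, (l < N)%N -> circle (a l)) ->
  mu.-integrable `[0, 2 * pi] (EFin \o (fun t => potential s a N (expi t))) /\
  \int[mu]_(t in `[0, 2 * pi]) potential s a N (expi t) =
    N%:R * (2 * pi * energy_sigma s).
Proof.
move=> s0; have pi0 := pi_gt0 R.
elim: N => [_|N IH ca].
  rewrite mul0r; split.
    rewrite (_ : _ \o _ = cst 0%E); first exact: integrable0.
    by apply/funext => t /=; rewrite potential0.
  under eq_Rintegral do rewrite potential0.
  by rewrite Rintegral_cst// mul0r.
have [|iN eN] := IH; first by move=> l lN; exact/ca/ltnW.
have [c c2pi zc] := expi_surj (a N) (ca _ (ltnSn N)).
have E t : potential s a N.+1 (expi t) =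
    potential s a N (expi t) + chord_power s (t - c).
  rewrite /potential big_ord_recr /=; congr (_ + _).
  by rewrite riesz_kernelC zc riesz_kernel_expi.
have ic := continuous_itv_integrable _ 0 (2 * pi)
  (continuous_shift_chord_power s c s0).
split.
  rewrite (_ : _ \o _ = (EFin \o (fun t => potential s a N (expi t))) \+
    (EFin \o (fun t => chord_power s (t - c))))%E; last first.
    by apply/funext => t /=; rewrite E.
  exact: integrableD.
under eq_Rintegral do rewrite E.
rewrite RintegralD// eN Rintegral_shift_chord_power// energy_sigmaE//.
have pin0 : 2 * pi != 0 :> R by rewrite gt_eqF// mulr_gt0.
by rewrite mulVKf// -[in RHS]natr1 [RHS]mulrDl [X in _ = _ + X]mul1r.
Qed.

(** The average over the circle of the potential of N points is
    [N%:R * energy_sigma s]. *)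
Lemma potential_mean_bounds s (a : nat -> R[i]) N L H : s < 0 ->
  (forall l, (l < N)%N -> circle (a l)) ->
  (forall z, circle z -> L <= potential s a N z <= H) ->
  L <= N%:R * energy_sigma s <= H.
Proof.
move=> s0 ca LH.
have pi0 : 0 < 2 * pi :> R by rewrite mulr_gt0// pi_gt0.
have [iU eU] := integral_potential s a N s0 ca.
have cstE (x : R) : \int[mu]_(t in `[0, 2 * pi]) (cst x t) = x * (2 * pi).
  rewrite Rintegral_cst//= lebesgue_measure_itv/= lte_fin pi0.
  by rewrite -EFinB subr0.
have icst (x : R) : mu.-integrable `[0, 2 * pi] (EFin \o cst x).
  exact: continuous_itv_integrable (@cst_continuous _ _ _).
have eU' : \int[mu]_(t in `[0, 2 * pi]) potential s a N (expi t) =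
    N%:R * energy_sigma s * (2 * pi) by rewrite eU; ring.
rewrite -(ler_pM2r pi0 L) -(ler_pM2r pi0 _ H) -eU' -!cstE.
apply/andP; split; apply: le_Rintegral => // t _ /=.
  by have /andP[] := LH _ (circle_expi t).
by have /andP[] := LH _ (circle_expi t).
Qed.

End circle_average.

(** * Energy of greedy sequences *)

Section energy_deviation.
Context {R : realType}.
Implicit Types (a : nat -> R[i]) (z w : R[i]) (n N r : nat).

(** The diagonal terms vanish since the kernel is zero at distance zero. *)
Lemma energyE s (xs : seq R[i]) : s < 0 ->
  energy s xs = \sum_(x <- xs) \sum_(y <- xs) riesz_kernel s x y.
Proof.
move=> s0; rewrite /energy [RHS](big_nth 0) big_mkord; apply: eq_bigr => i _.
rewrite [RHS](big_nth 0) big_mkord [RHS](bigD1 i)//=.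
by rewrite riesz_kernelzz// add0r.
Qed.

Lemma energy_rcons s (xs : seq R[i]) z : s < 0 ->
  energy s (rcons xs z) = energy s xs + 2 * \sum_(x <- xs) riesz_kernel s z x.
Proof.
move=> s0; rewrite !energyE// big_rcons /=.
under eq_bigr do rewrite big_rcons /=.
rewrite big_split /= big_rcons /= riesz_kernelzz// addr0.
have -> : \sum_(x <- xs) riesz_kernel s x z = \sum_(x <- xs) riesz_kernel s z x.
  by apply: eq_bigr => x _; exact: riesz_kernelC.
rewrite mulr_natl mulr2n; ring.
Qed.

Lemma greedy_uptoP s a N : s < 0 -> greedy s a -> greedy_upto s a N.
Proof.
move=> s0 [ca ga]; split => [l _|l /andP[l0 _] z cz]; first exact: ca.
have [_ /(_ (energy s (rcons (mkseq a l) z)))] := ga l l0.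
have sumE w : \sum_(x <- mkseq a l) riesz_kernel s w x = potential s a l w.
  rewrite /mkseq big_map (_ : iota 0 l = index_iota 0 l) ?big_mkord//.
  by rewrite /index_iota subn0.
rewrite !energy_rcons// !sumE lerD2l ler_pM2l//; apply.
by exists z => //=; rewrite energy_rcons// sumE.
Qed.

Definition pair_energy s a N : R := \sum_(i < N) potential s a N (a i).

Lemma pair_energyD s a N r : pair_energy s a (N + r) =
  pair_energy s a N + 2 * \sum_(i < r) potential s a N (tail_from a N i) +
  pair_energy s (tail_from a N) r.
Proof.
rewrite /pair_energy big_split_ord /=.
under eq_bigr do rewrite potentialD.
under [X in _ + X]eq_bigr do rewrite potentialD.
rewrite !big_split /=.
have -> : \sum_(i < N) potential s (tail_from a N) r (a i) =
    \sum_(i < r) potential s a N (tail_from a N i).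
  rewrite /potential exchange_big /=; apply: eq_bigr => i _.
  by apply: eq_bigr => j _; rewrite riesz_kernelC.
rewrite mulr_natl mulr2n; ring.
Qed.

Lemma sum_potential s a N : s < 0 ->
  2 * \sum_(1 <= k < N.+1) potential s a k (a k) = pair_energy s a N.+1.
Proof.
move=> s0; elim: N => [|N IH].
  rewrite big_geq// mulr0 /pair_energy big_ord1 /potential big_ord1.
  by rewrite riesz_kernelzz.
rewrite big_nat_recr//= mulrDr IH -[N.+2]addn1 pair_energyD big_ord1.
rewrite /pair_energy big_ord1 /tail_from /potential big_ord1 addn0 riesz_kernelzz//.
by rewrite addr0.
Qed.

(** The successive potentials add up to half the energy of the first N + 1
    points, and (N + 1)^2 - 1 = N (N + 2); this is where the limit
    [energy_sigma s / 2] comes from. *)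
Lemma mean_deviationE s a N : s < 0 -> (0 < N)%N ->
  mean_deviation s a N - energy_sigma s / 2 =
  (pair_energy s a N.+1 - N.+1%:R ^+ 2 * energy_sigma s + energy_sigma s) /
    (2 * N%:R).
Proof.
move=> s0 N0; rewrite /mean_deviation sumrB -mulr_suml -sum_potential//.
have -> : \sum_(1 <= k < N.+1) k%:R = N%:R * (N%:R + 1) / 2 :> R.
  elim: N {N0} => [|N IH]; first by rewrite big_geq// !mul0r.
  by rewrite big_nat_recr//= IH -(natr1 N); field.
have N0' : N%:R != 0 :> R by rewrite pnatr_eq0 -lt0n.
rewrite -(natr1 N); move: (N%:R : R) N0' => x x0.
by move: (energy_sigma s) => I; field.
Qed.

Section exponent.
Variables (s : R) (hs : -2 < s < 0).
Let s0 : s < 0. Proof. by case/andP: hs. Qed.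
Local Notation Is := (energy_sigma s).

(** The mean value of the potential lies between its extreme values, which are
    close by [root_potential_gap]. *)
Lemma root_potential_deviation n a z : root_system n a -> circle z ->
  `|potential s a (2 ^ n) z - (2 ^ n)%:R * Is| <= (8 / 4 ^+ n) `^ (- s / 2).
Proof.
move=> ra cz; have [ca _ _] := ra.
set d := _ `^ _.
have := potential_mean_bounds s a (2 ^ n)
  (potential s a (2 ^ n) z - d) (potential s a (2 ^ n) z + d) s0 ca.
move=> /(_ _)/andP[|h1 h2]; last by rewrite ler_norml; lra.
move=> w cw; apply/andP; split; last exact: root_potential_gap.
by rewrite lerBlDr; exact: root_potential_gap.
Qed.

Lemma pair_energy_root_deviation n a : root_system n a ->
  `|pair_energy s a (2 ^ n) - (2 ^ n)%:R ^+ 2 * Is| <=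
  (2 ^ n)%:R * (8 / 4 ^+ n) `^ (- s / 2).
Proof.
move=> ra; have [ca _ _] := ra.
rewrite /pair_energy expr2 -mulrA mulr_natl.
rewrite -[X in _ *+ X]card_ord -sumr_const -sumrB.
apply: le_trans (ler_norm_sum _ _ _) _.
rewrite [leRHS]mulr_natl -[X in _ <= _ *+ X]card_ord -sumr_const.
apply: ler_sum => i _; apply: root_potential_deviation => //; exact: ca.
Qed.

(** Suppose 2^n <= N = 2^n + r < 2^(n+1).  The energy splits into that of the root
    system formed by the first 2^n points, twice the potential of this system
    summed over the r other points, and the energy of these r points, which are
    again greedy.  The squares split alike,
    (2^n + r)^2 = (2^n)^2 + 2 r 2^n + r^2, so the deviations add up; the first two
    pieces contribute at most 3 * 2^n times the oscillation of the potential. *)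
Lemma pair_energy_deviation n a N : (N < 2 ^ n)%N -> greedy_upto s a N ->
  `|pair_energy s a N - N%:R ^+ 2 * Is| <=
  \sum_(k < n) 3 * ((2 ^ k)%:R * (8 / 4 ^+ k) `^ (- s / 2)).
Proof.
elim: n a N => [|n IH] a N Nn ga.
  move: Nn; rewrite expn0 ltnS leqn0 => /eqP ->.
  by rewrite /pair_energy !big_ord0 expr0n mul0r subrr normr0.
rewrite big_ord_recr /=; set d := _ `^ _; set M := (2 ^ n)%N.
have d0 : 0 <= d by exact: powR_ge0.
have [NM|MN] := ltnP N M.
  apply: le_trans (IH _ _ NM ga) _.
  by rewrite lerDl mulr_ge0// mulr_ge0.
pose r := (N - M)%N.
have rN : N = (M + r)%N by rewrite subnKC.
have rM : (r < M)%N by rewrite ltn_subLR// addnn -mul2n -expnS.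
rewrite rN in ga *.
have ra : root_system n a.
  by apply/(greedy_root_system _ hs)/(greedy_uptoW _ _ _ _ _ ga)/leq_addr.
have gb := greedy_tail _ hs _ _ _ (ltnW rM) ga.
have h1 := pair_energy_root_deviation _ _ ra.
have h3 := IH _ _ rM gb.
have h2 : `|\sum_(i < r) potential s a M (tail_from a M i) - r%:R * (M%:R * Is)| <=
    M%:R * d.
  apply: (@le_trans _ _ (r%:R * d)); last first.
    by rewrite ler_wpM2r// ler_nat ltnW.
  rewrite mulr_natl -[X in _ *+ X]card_ord -sumr_const -sumrB.
  apply: le_trans (ler_norm_sum _ _ _) _.
  rewrite [leRHS]mulr_natl -[X in _ <= _ *+ X]card_ord -sumr_const.
  apply: ler_sum => i _; apply: root_potential_deviation => //.
  by have [cb _] := gb; exact: cb.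
rewrite pair_energyD natrD.
move: h1 h2 h3; rewrite -/M -/d.
set A := pair_energy s a M; set B := \sum_(i < r) _; set C := pair_energy _ _ r.
set S := \sum_(k < n) _; rewrite !ler_norml => h1 h2 h3.
rewrite -/M; move: h1 h2 h3; move: (M%:R : R) (r%:R : R) => x y h1 h2 h3.
have -> : A + 2 * B + C - (x + y) ^+ 2 * Is =
  (A - x ^+ 2 * Is) + 2 * (B - y * (x * Is)) + (C - y ^+ 2 * Is) by ring.
lra.
Qed.

Lemma gap_geometric k :
  (2 ^ k)%:R * (8 / 4 ^+ k) `^ (- s / 2) =
  8 `^ (- s / 2) * (2 `^ (1 + s)) ^+ k :> R.
Proof.
rewrite powRM ?invr_ge0 ?exprn_ge0// mulrCA; congr (_ * _).
have -> : (4 ^+ k)^-1 = 2 `^ (- (2 * k%:R)) :> R.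
  by rewrite powRN mulrC powRrM powR_mulrn ?powR_mulrn// -exprM mulnC exprM; congr (_ ^+ _ )^-1; ring.
rewrite -powRrM natrX -powR_mulrn// -powR_mulrn ?powR_ge0// -powRrM -powRD ?pnatr_eq0 ?implybT//.
by congr powR; field.
Qed.

(** Each binary digit of N + 1 costs one term of a geometric progression of
    ratio 2^(1+s); the three regimes of the theorem correspond to this ratio being
    greater than, equal to, or smaller than 1. *)
Lemma mean_deviation_bound : exists2 K, 0 <= K &
  forall N a, (0 < N)%N -> greedy s a ->
    `|mean_deviation s a N - Is / 2| <=
    (K * \sum_(k < (trunc_log 2 N.+1).+1) (2 `^ (1 + s)) ^+ k + `|Is|) /
      (2 * N%:R).
Proof.
exists (3 * 8 `^ (- s / 2)); first by rewrite mulr_ge0// powR_ge0.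
move=> N a N0 ga; rewrite mean_deviationE//.
rewrite normrM [X in _ * X]ger0_norm ?invr_ge0 ?mulr_ge0//.
rewrite ler_wpM2r ?invr_ge0 ?mulr_ge0//.
apply: le_trans (ler_normD _ _) _; rewrite lerD2r.
have NT : (N.+1 < 2 ^ (trunc_log 2 N.+1).+1)%N by apply: trunc_log_ltn.
apply: le_trans (pair_energy_deviation _ _ _ NT (greedy_uptoP _ _ _ s0 ga)) _.
rewrite mulr_sumr; apply: ler_sum => k _.
by rewrite gap_geometric mulrA.
Qed.

End exponent.
End energy_deviation.

(** * Rates of convergence *)

Section rates.
Context {R : realType}.
Implicit Types (a : nat -> R[i]) (n N m : nat).

Lemma geometric_sum_gt1 (x : R) m : 1 < x ->
  \sum_(k < m.+1) x ^+ k <= x / (x - 1) * x ^+ m.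
Proof.
move=> x1; rewrite mulrAC ler_pdivlMr ?subr_gt0//.
rewrite mulrC -subrX1 exprS; lra.
Qed.

Lemma geometric_sum_lt1 (x : R) m : 0 <= x < 1 ->
  \sum_(k < m) x ^+ k <= (1 - x)^-1.
Proof.
move=> /andP[x0 x1]; rewrite -[leRHS]mul1r ler_pdivlMr ?subr_gt0//.
have := subrX1 x m; rewrite mulrC; set S := \sum_(k < m) _ => e.
have := exprn_ge0 m x0; nra.
Qed.

Lemma ltr_powR2 (u v : R) : u < v -> 2 `^ u < 2 `^ v.
Proof.
by move=> uv; rewrite /powR pnatr_eq0 ltr_expR ltr_pM2r// ln_gt0// ltr1n.
Qed.

Lemma powR_natr_cvg0 (t : R) : t < 0 -> N%:R `^ t @[N --> \oo] --> (0 : R).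
Proof.
move=> t0.
have -> : (fun N => N%:R `^ t) = (fun N => `|(N%:R : R)^-1| `^ (- t)).
  by apply/funext => N; rewrite ger0_norm// -powR_inv1// -powRrM mulN1r opprK.
have Z : `|0 : R| `^ (- t) = 0 by rewrite normr0 powR0// oppr_eq0 lt_eqF.
rewrite -[X in _ --> X]Z.
apply: (@cvg_comp _ _ _ (fun N => (N%:R : R)^-1) (fun x => `|x| `^ (- t))
    _ (nbhs (0 : R))).
  rewrite gtr0_cvgV0; first exact: cvgr_idn.
  by near=> N; rewrite ltr0n; near: N; exact: nbhs_infty_gt.
by apply: (continuous_powR_norm (- t) _ 0); rewrite oppr_gt0.
Unshelve. all: by end_near. Qed.

Lemma trunc_log_le2 N : (0 < N)%N -> 2 ^+ trunc_log 2 N.+1 <= 2 * N%:R :> R.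
Proof.
move=> N0; rewrite -natrX -natrM ler_nat.
by apply: leq_trans (trunc_logP _ _) _ => //; rewrite mul2n -addnn -addn1 leq_add2l.
Qed.

Section exponent.
Variables (s : R) (hs : -2 < s < 0).
Local Notation Is := (energy_sigma s).

(** Allowing an exponent t larger than s makes this estimate also serve the
    limit when s <= -1. *)
Lemma rate_power (t : R) : s <= t -> -1 < t -> t < 0 ->
  exists C, forall N a, (0 < N)%N -> greedy s a ->
    `|mean_deviation s a N - Is / 2| <= C * N%:R `^ t.
Proof.
move=> st t1 t0; have [K K0 HK] := mean_deviation_bound s hs.
pose x : R := 2 `^ (1 + t).
have x1 : 1 < x by rewrite -(powRr0 2) /x ltr_powR2//; lra.
exists (K * (x / (x - 1)) + `|Is|) => N a N0 ga.
apply: le_trans (HK N a N0 ga) _.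
have N0' : 0 < N%:R :> R by rewrite ltr0n.
set m := trunc_log 2 N.+1.
have S1 : \sum_(k < m.+1) (2 `^ (1 + s)) ^+ k <= x / (x - 1) * (2 * N%:R) `^ (1 + t).
  apply: (@le_trans _ _ (\sum_(k < m.+1) x ^+ k)).
    apply: ler_sum => k _; rewrite lerXn2r ?nnegrE ?powR_ge0//.
    by rewrite ler_powR// ?ler1n//; lra.
  apply: le_trans (geometric_sum_gt1 _ _ x1) _.
  rewrite ler_wpM2l//; first by rewrite divr_ge0//; lra.
  rewrite -powR_mulrn ?powR_ge0// -powRrM mulrC powRrM powR_mulrn//.
  rewrite ge0_ler_powR ?nnegrE ?exprn_ge0 ?mulr_ge0//; first lra.
  exact: trunc_log_le2.
rewrite ler_pdivrMr ?mulr_gt0// mulrDl mulrDl.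
have P : (2 * N%:R) `^ (1 + t) <= N%:R `^ t * (2 * N%:R) :> R.
  rewrite powRD; last by rewrite gt_eqF//; lra.
  rewrite powRr1 ?mulr_ge0// mulrC ler_wpM2r ?mulr_ge0//.
  rewrite powRM// ger_pMl ?powR_gt0//.
  by rewrite -[leRHS](powRr0 2) ler_powR ?ler1n//; lra.
apply: lerD.
  rewrite -!mulrA ler_wpM2l//.
  apply: le_trans S1 _; rewrite -!mulrA ler_wpM2l ?(ltW (lt_trans ltr01 x1))//.
  by rewrite ler_wpM2l// invr_ge0; lra.
rewrite -mulrA ler_peMr//.
apply: le_trans P; rewrite -[leLHS](powRr0 (2 * N%:R)) ler_powR//; last lra.
by rewrite -natrM ler1n muln_gt0.
Qed.

Lemma rate_log : s = -1 ->
  exists C, forall N a, (1 < N)%N -> greedy s a ->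
    `|mean_deviation s a N - Is / 2| <= C * (N%:R^-1 * ln N%:R).
Proof.
move=> s1; have [K K0 HK] := mean_deviation_bound s hs.
have l2 : 0 < ln 2 :> R by rewrite ln_gt0// ltr1n.
(* trunc_log 2 N.+1 <= 2 ln N / ln 2 and 1 <= ln N / ln 2, whence the 3 *)
exists ((3 * K + `|Is|) / ln 2) => N a N1 ga; have N0 := ltnW N1.
apply: le_trans (HK N a N0 ga) _.
have N0' : 0 < N%:R :> R by rewrite ltr0n.
set m := trunc_log 2 N.+1.
have -> : \sum_(k < m.+1) (2 `^ (1 + s)) ^+ k = m%:R + 1 :> R.
  rewrite s1 subrr powRr0.
  by under eq_bigr do rewrite expr1n; rewrite sumr_const card_ord natr1.
have lN : ln 2 <= ln N%:R :> R by rewrite ler_ln ?posrE// ler_nat.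
have mN : m%:R * ln 2 <= 2 * ln N%:R :> R.
  rewrite !mulr_natl -!lnXn// ler_ln ?posrE ?exprn_gt0//.
  rewrite -!natrX ler_nat.
  apply: leq_trans (trunc_logP _ _) _ => //.
  rewrite -mulnn (@leq_trans (2 * N))//; last by rewrite leq_mul2r N1 orbT.
  by rewrite mul2n -addnn -addn1 leq_add2l.
have -> : (3 * K + `|Is|) / ln 2 * (N%:R^-1 * ln N%:R) =
  (3 * K * ln N%:R + `|Is| * ln N%:R) / ln 2 / N%:R.
  by field; rewrite !gt_eqF.
rewrite invfM mulrA; apply: ler_pM => //.
  by rewrite divr_ge0// addr_ge0// mulr_ge0// addr_ge0.
rewrite ler_pdivlMr//.
have A : 0 <= K * (2 * ln N%:R - m%:R * ln 2) by rewrite mulr_ge0// subr_ge0.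
have B : 0 <= K * (ln N%:R - ln 2) by rewrite mulr_ge0// subr_ge0.
have C : 0 <= `|Is| * (ln N%:R - ln 2) by rewrite mulr_ge0// subr_ge0.
have D : 0 <= K * ln N%:R by rewrite mulr_ge0// (le_trans (ltW l2)).
have E : 0 <= `|Is| * ln N%:R by rewrite mulr_ge0// (le_trans (ltW l2)).
have -> : (K * (m%:R + 1) + `|Is|) / 2 * ln 2 =
  (K * (m%:R * ln 2) + K * ln 2 + `|Is| * ln 2) / 2 by field.
nra.
Qed.

Lemma rate_inverse : s < -1 ->
  exists C, forall N a, (0 < N)%N -> greedy s a ->
    `|mean_deviation s a N - Is / 2| <= C * N%:R^-1.
Proof.
move=> s1; have [K K0 HK] := mean_deviation_bound s hs.
have x01 : (0 : R) <= 2 `^ (1 + s) < 1.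
  rewrite powR_ge0 -[ltRHS](powRr0 2) ltr_powR2//; lra.
exists (K / (1 - 2 `^ (1 + s)) + `|Is|) => N a N0 ga.
apply: le_trans (HK N a N0 ga) _.
have N0' : 0 < N%:R :> R by rewrite ltr0n.
apply: ler_pM => //.
- by rewrite addr_ge0// mulr_ge0// sumr_ge0// => k _; rewrite exprn_ge0// powR_ge0.
- by rewrite lerD2r ler_wpM2l// geometric_sum_lt1.
by rewrite lef_pV2 ?posrE ?mulr_gt0//; lra.
Qed.

Lemma mean_deviation_cvg a : greedy s a ->
  mean_deviation s a N @[N --> \oo] --> Is / 2.
Proof.
move=> ga; have /andP[s2 s0] := hs.
(* any t in ]-1, 0[ with s <= t will do *)
pose t := Num.max s (- 2^-1).
have [|||C HC] := rate_power t.
- by rewrite le_max lexx.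
- by rewrite lt_max; apply/orP; right; lra.
- by rewrite gt_max s0; lra.
have t0 : t < 0 by rewrite gt_max s0; lra.
apply/subr_cvg0/norm_cvg0P/(squeeze_cvgr _ (cvg_cst 0)); last first.
  rewrite -(mulr0 C); apply: cvgMr; exact: powR_natr_cvg0 t0.
near=> N; rewrite normr_ge0/=; apply: HC => //.
by near: N; exact: nbhs_infty_gt.
Unshelve. all: by end_near. Qed.

End exponent.
End rates.

(** * The theorem *)

Theorem theorem9p2 (R : realType) (s : R) (hs : -2 < s < 0) :
  (forall a : nat -> R[i], greedy s a ->
     mean_deviation s a N @[N --> \oo] --> energy_sigma s / 2) /\
  (-1 < s -> exists C : R, \forall N \near \oo,
     forall a : nat -> R[i], greedy s a ->
       `|mean_deviation s a N - energy_sigma s / 2| <= C * N%:R `^ s) /\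
  (s = -1 -> exists C : R, \forall N \near \oo,
     forall a : nat -> R[i], greedy s a ->
       `|mean_deviation s a N - energy_sigma s / 2|
         <= C * (N%:R^-1 * ln N%:R)) /\
  (s < -1 -> exists C : R, \forall N \near \oo,
     forall a : nat -> R[i], greedy s a ->
       `|mean_deviation s a N - energy_sigma s / 2| <= C * N%:R^-1).
Proof.
split; first exact: mean_deviation_cvg.
have s0 : s < 0 by case/andP: hs.
split=> [s1|].
  have [C HC] := rate_power s hs s (lexx s) s1 s0.
  exists C; near=> N => a; apply: HC.
  by near: N; exact: nbhs_infty_gt.
split=> [s1|s1].
  have [C HC] := rate_log s hs s1.
  exists C; near=> N => a; apply: HC.
  by near: N; exact: nbhs_infty_gt.
have [C HC] := rate_inverse s hs s1.
exists C; near=> N => a; apply: HC.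
by near: N; exact: nbhs_infty_gt.
Unshelve. all: by end_near. Qed.
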